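(* For every $n\ge 0$, the number of 021-avoiding descent sequences of length $n$ equals the number of Dyck paths of size $n$ that avoid $UUDU$.
   Context: A descent sequence of length $n\ge1$ is a sequence $a_1a_2\dots a_n$ of nonnegative integers with $a_1=0$ and, for each $i\ge 2$, $a_i\le 1+\#\{j\in[1,i-2]: a_j>a_{j+1}\}$; the empty sequence is the descent sequence of length 0. A sequence avoids 021 if there are no indices $i<j<k$ with $a_i<a_k<a_j$. A Dyck path of size (semilength) $n$ is a word with $n$ letters $U$ and $n$ letters $D$ in which every prefix contains at least as many $U$'s as $D$'s. A Dyck path avoids $UUDU$ if it has no four consecutive steps equal to $U,U,D,U$ in this order. *)

(* Defs.v *)
From mathcomp Require Import all_boot.

Set Implicit Arguments.
Unset Strict Implicit.
Unset Printing Implicit Defensive.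

(* Sequences are indexed from 0: the entry a_i of a_1 ... a_n is [nth 0 a i.-1]. *)

(* #{j in [1, m] : a_j > a_(j+1)} *)
Definition num_descents (a : seq nat) (m : nat) : nat :=
  #|[set j : 'I_m | nth 0 a j > nth 0 a j.+1]|.

(* With i the 0-based index, the bound on the entry a_(i+1) counts the descents
   at positions in [1, i - 1].  For the empty sequence both conjuncts hold. *)
Definition descent_sequence (a : seq nat) : bool :=
  (nth 0 a 0 == 0) &&
  [forall i : 'I_(size a), (0 < i) ==> (nth 0 a i <= 1 + num_descents a i.-1)].

Definition avoids_021 (a : seq nat) : bool :=
  ~~ [exists i : 'I_(size a), exists j : 'I_(size a), exists k : 'I_(size a),
        [&& i < j, j < k, nth 0 a i < nth 0 a k & nth 0 a k < nth 0 a j]].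

Definition U : bool := true.
Definition D : bool := false.

Definition dyck_path (n : nat) (w : seq bool) : bool :=
  [&& count_mem U w == n, count_mem D w == n &
      [forall m : 'I_(size w).+1,
         count_mem D (take m w) <= count_mem U (take m w)]].

Definition avoids_UUDU (w : seq bool) : bool := ~~ infix [:: U; U; D; U] w.

(* The entries of a descent sequence of length n are smaller than n, and a Dyck
   path of size n has length 2n, so the finite types of tuples over which the two
   families are counted below lose nothing. *)
Lemma descent_sequence_bound (a : seq nat) :
  descent_sequence a -> all (fun x => x < size a) a.
Proof.
case/andP=> /eqP a0 /forallP dsa; apply/(all_nthP 0) => i lt_i.
case: i lt_i => [|i] lt_i; first by rewrite a0.
have ds_i := dsa (Ordinal lt_i); rewrite /= in ds_i; apply: leq_ltn_trans ds_i _.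
apply: leq_ltn_trans (lt_i); rewrite add1n ltnS /num_descents.
by rewrite (leq_trans (max_card _)) ?card_ord.
Qed.

Lemma dyck_path_size (n : nat) (w : seq bool) : dyck_path n w -> size w = 2 * n.
Proof.
case/and3P=> /eqP cU /eqP cD _; rewrite -(count_predC (pred1 U) w) cU mul2n -addnn.
by congr (_ + _); rewrite -cD; apply: eq_count; case.
Qed.

Definition descent_sequences_021 (n : nat) : {set n.-tuple 'I_n} :=
  [set t : n.-tuple 'I_n | let a := map (@nat_of_ord n) t in
                           descent_sequence a && avoids_021 a].

Definition dyck_paths_UUDU (n : nat) : {set (2 * n).-tuple bool} :=
  [set w : (2 * n).-tuple bool | dyck_path n w && avoids_UUDU w].

(* Main.v *)
Require Import Defs.
From mathcomp Require Import all_boot zify.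

Set Implicit Arguments.
Unset Strict Implicit.
Unset Printing Implicit Defensive.

(** Both families are counted through the power series [P] and [c] in [x] with
    [c = 1 + x P c] and [P = 1 + x / (1 - x) c].  Reading a word letter by
    letter, the generating function of its completions depends only on a small
    state and is always (up to a factor [1 / (1 - x)]) a monomial [P^a c^b].

    A sequence starting with 0 avoids 021 iff its nonzero entries increase
    weakly.  If [s] is the difference between the bound on a nonzero next entry
    and the largest entry so far (or 1), the completions have generating
    function [c^(s+1) / (1 - x)] after an entry 0, and [P c^(s+1)] after a
    nonzero entry.

    For Dyck paths at height [h], with [x] marking the steps [U] to come, it is
    [P^(h+1)] when the preceding steps impose no constraint, [P^h] after [UUD],
    [P^(h-1) c / (1 - x)] after a single [U], and [P^(h-1) c] after [UU].

    Both counts are the coefficients of [P]. *)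

(** * Counting tuples letter by letter *)

Lemma card_tuple_cons (T : finType) (n : nat) (p : pred (seq T)) :
  #|[set t : n.+1.-tuple T | p t]| =
  \sum_(x : T) #|[set t : n.-tuple T | p (x :: t)]|.
Proof.
rewrite -sum1_card (partition_big (fun t : n.+1.-tuple T => thead t) predT) //=.
apply: eq_bigr => x _; rewrite -sum1dep_card.
rewrite (reindex_onto (fun t : n.-tuple T => [tuple of x :: t])
                      (fun t => [tuple of behead t])) /=; last first.
  by move=> t /andP[_ /eqP <-]; rewrite -tuple_eta.
apply: eq_bigl => t; rewrite inE /= theadE eqxx andbT.
by rewrite (_ : [tuple of _] = t) ?eqxx ?andbT //; apply: val_inj.
Qed.

Lemma card_tuple0 (T : finType) (p : pred (seq T)) :
  #|[set t : 0.-tuple T | p t]| = p [::].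
Proof.
case: (boolP (p [::])) => p0; last first.
  by apply: eq_card0 => t; rewrite inE tuple0 (negPf p0).
rewrite -[RHS](cards1 ([tuple] : 0.-tuple T)); apply: eq_card => t.
by rewrite !inE [t]tuple0 p0 eqxx.
Qed.

(** * Coefficients of the monomials [P^a c^b] *)

(* The coefficients of [x^n] in [P^a c^b] and in [x / (1 - x) P^a c^b]. *)
Fixpoint weight_pair (n : nat) : (nat -> nat -> nat) * (nat -> nat -> nat) :=
  if n is n'.+1 then
    let: (w, s) := weight_pair n' in
    let s' a b := s a b + w a b in
    (fun a b => \sum_(j < b) w 1 j.+1 + \sum_(i < a) s' i b.+1, s')
  else (fun _ _ => 1, fun _ _ => 0).

Definition weight (n : nat) := (weight_pair n).1.
Definition weight_lt (n : nat) := (weight_pair n).2.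

Lemma weight00 n : weight n 0 0 = (n == 0).
Proof. by case: n => [|n] //; rewrite /weight /=; case: weight_pair => w s /=; rewrite !big_ord0. Qed.

Lemma weight_ltS n a b : weight_lt n.+1 a b = weight_lt n a b + weight n a b.
Proof. by rewrite /weight_lt /weight /=; case: weight_pair. Qed.

(** The equation for [P] times [P^a c^b]. The recursion in [weight_pair] is this equation telescoped
    over [i < a], on top of [c^b - 1] telescoped over [j < b]. *)
Lemma weight_P n a b : weight n a.+1 b = weight n a b + weight_lt n a b.+1.
Proof.
case: n => [|n] //; rewrite /weight_lt /weight /=; case: weight_pair => w s /=.
by rewrite big_ord_recr /= addnA.
Qed.

Lemma weight_sum n b : weight n.+1 0 b = \sum_(j < b) weight n 1 j.+1.
Proof. by rewrite /weight /=; case: weight_pair => w s /=; rewrite big_ord0 addn0. Qed.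

(* The equation for [c]; the definition of [weight_pair] only gives it at [a = 0]. *)
Lemma weight_c n a b : weight n.+1 a b.+1 = weight n.+1 a b + weight n a.+1 b.+1.
Proof.
(* At a fixed coefficient the equation passes from [weight_lt] to [weight] by induction on the
   exponent of [P]. As [weight_lt] accumulates the earlier weights, induction on [n] then supplies
   its half. *)
have step m :
    (forall i j, weight_lt m.+1 i j.+1 =
                 weight_lt m.+1 i j + weight_lt m i.+1 j.+1) ->
    forall i j, weight m.+1 i j.+1 = weight m.+1 i j + weight m i.+1 j.+1.
  move=> lt_m; elim=> [|i IHi] j; first by rewrite !weight_sum big_ord_recr.
  rewrite (weight_P m.+1 i j.+1) IHi lt_m (weight_P m.+1 i j) (weight_P m i.+1).
  lia.
apply: (step n) => {a b}; elim: n => [|n IHn] i j; first by rewrite !weight_ltS.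
rewrite weight_ltS IHn (step _ IHn) [weight_lt n.+2 i j]weight_ltS.
by rewrite [weight_lt n.+1 i.+1 _]weight_ltS; lia.
Qed.

(** * Dyck paths avoiding [UUDU] *)

Fixpoint dyck_from (h : nat) (w : seq bool) : bool :=
  if w is x :: w' then
    if x then dyck_from h.+1 w' else (0 < h) && dyck_from h.-1 w'
  else h == 0.

Lemma dyck_fromP h w :
  reflect (h + count_mem U w = count_mem D w /\
           forall m, m <= size w -> count_mem D (take m w) <= h + count_mem U (take m w))
          (dyck_from h w).
Proof.
elim: w h => [|[] w IHw] h /=.
- by apply: (iffP eqP) => [->|[]]; [split=> // -[] | lia].
- apply: (iffP (IHw _)) => -[e le_m]; split; try by move: e => /=; lia.
    by case=> [|m] // /le_m; rewrite /= add0n addnA addn1.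
  by move=> m lt_m; have := le_m m.+1 lt_m; rewrite /= add0n addnA addn1.
case: h => [|h] /=.
  by apply: ReflectF => -[_ /(_ 1 isT)]; rewrite /= take0.
apply: (iffP (IHw _)) => -[e le_m]; split; try by move: e => /=; lia.
  by case=> [|m] // /le_m; rewrite /= add0n add1n addSn ltnS.
by move=> m lt_m; have := le_m m.+1 lt_m; rewrite /= add0n add1n addSn ltnS.
Qed.

Lemma dyck_path_from n w : size w = 2 * n -> dyck_path n w = dyck_from 0 w.
Proof.
move=> sz_w; have cUD : count_mem U w + count_mem D w = 2 * n.
  by rewrite -sz_w -(count_predC (pred1 U) w); congr (_ + _); apply: eq_count; case.
apply/and3P/dyck_fromP => [[/eqP cU /eqP cD /forallP le_m]|[e le_m]].
  split=> [|m le_mw]; first by lia.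
  exact: (le_m (Ordinal (le_mw : m < (size w).+1))).
split; [apply/eqP; lia | apply/eqP; lia |].
by apply/forallP => -[m lt_m]; apply: le_m.
Qed.

(* The prefix [s] stands for the last steps before the word that is counted. *)
Definition dyck_count (l h : nat) (s : seq bool) : nat :=
  #|[set t : l.-tuple bool | dyck_from h t && avoids_UUDU (s ++ t)]|.

Lemma dyck_count_lt l h s : l < h -> dyck_count l h s = 0.
Proof.
move=> lt_lh; apply: eq_card0 => t; rewrite inE; apply/negP => /andP[/dyck_fromP[e _] _].
by have := count_size (pred1 D) t; rewrite size_tuple -e leqNgt ltn_addr.
Qed.

(** Here [n] is the number of steps [U] to come. Reading one more step yields the equation for [P]
    with no constraint, the equation for [c] after [UU], and a combination of both after a single
    [U]. *)
Lemma dyck_countE l n h : l = 2 * n + h ->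
  [/\ dyck_count l h [::] = weight n h.+1 0,
      dyck_count l h [:: U; U; D] = weight n h 0,
      0 < h -> dyck_count l h [:: U] = weight_lt n.+1 h.-1 1 &
      0 < h -> dyck_count l h [:: U; U] = weight n h.-1 1].
Proof.
elim: l n h => [|l IHl] n h e.
  have [-> ->] : n = 0 /\ h = 0 by lia.
  by split=> //; rewrite /dyck_count (card_tuple0 (fun t => dyck_from 0 t && avoids_UUDU (_ ++ t))).
have cS s : dyck_count l.+1 h s =
    #|[set t : l.-tuple bool | dyck_from h.+1 t && avoids_UUDU (s ++ U :: t)]|
  + #|[set t : l.-tuple bool | [&& 0 < h, dyck_from h.-1 t & avoids_UUDU (s ++ D :: t)]]|.
  rewrite /dyck_count (card_tuple_cons l (fun t => dyck_from h t && avoids_UUDU (s ++ t))).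
  by rewrite big_bool; congr (_ + _); apply: eq_card => t; rewrite !inE /= ?andbA.
(* In [cU] and [cD], [s'] keeps only those last steps that can still begin an occurrence of
   [UUDU]. *)
have cU s s' : (forall t, avoids_UUDU (s ++ U :: t) = avoids_UUDU (s' ++ t)) ->
    #|[set t : l.-tuple bool | dyck_from h.+1 t && avoids_UUDU (s ++ U :: t)]| = dyck_count l h.+1 s'.
  by move=> es; apply: eq_card => t; rewrite !inE es.
have cD s s' : (forall t, avoids_UUDU (s ++ D :: t) = avoids_UUDU (s' ++ t)) ->
    #|[set t : l.-tuple bool | [&& 0 < h, dyck_from h.-1 t & avoids_UUDU (s ++ D :: t)]]|
    = if 0 < h then dyck_count l h.-1 s' else 0.
  move=> es; case: (0 < h) => /=; last by apply: eq_card0 => t; rewrite inE.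
  by apply: eq_card => t; rewrite !inE es.
have avUUDU t : avoids_UUDU [:: U, U, D, U & t] = false by rewrite /avoids_UUDU /= prefix0s.
have IHU s : n = 0 -> dyck_count l h.+1 s = 0 by move=> n0; apply: dyck_count_lt; lia.
have IHD : 0 < h -> dyck_count l h.-1 [::] = weight n h 0.
  by move=> h0; have [-> _ _ _] := IHl n h.-1 ltac:(lia); rewrite prednK.
have IHD' : 0 < h -> dyck_count l h.-1 [:: U; U; D] = weight n h.-1 0.
  by move=> h0; have [_ -> _ _] := IHl n h.-1 ltac:(lia).
split.
- rewrite cS (cU [::] [:: U]) // (cD [::] [::]) // weight_P.
  have -> : (if 0 < h then dyck_count l h.-1 [::] else 0) = weight n h 0.
    (* At height 0 no step [D] is possible; as steps remain, [n > 0] and [weight n 0 0] vanishes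
       too. *)
    by case: posnP => [h0|/IHD //]; rewrite h0 weight00; case: n e {IHU IHD IHD'} => // ; lia.
  rewrite addnC; congr (_ + _); case: n e IHU {IHD IHD'} => [|n] e; first by move=> ->.
  by have [_ _ -> // _] := IHl n h.+1 ltac:(lia).
- rewrite cS (cD [:: U; U; D] [::]) // eq_card0 ?add0n => [|t]; last by rewrite inE avUUDU andbF.
  by case: posnP => [h0|/IHD //]; rewrite h0 weight00; case: n e {IHU IHD IHD'} => // ; lia.
- move=> h0; rewrite cS (cU [:: U] [:: U; U]) // (cD [:: U] [::]) // h0 IHD //.
  case: h h0 e {cS cU cD IHD IHD'} IHU => // h _ e IHU /=; rewrite weight_ltS.
  case: n e IHU => [|n] e IHU; first by rewrite IHU.
  have [_ _ _ -> //] := IHl n h.+2 ltac:(lia).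
  by rewrite /= weight_c (weight_P n.+1 h 0); lia.
- move=> h0; rewrite cS (cU [:: U; U] [:: U; U]) // (cD [:: U; U] [:: U; U; D]) // h0 IHD' //.
  case: h h0 e {cS cU cD IHD IHD'} IHU => // h _ e IHU /=.
  case: n e IHU => [|n] e IHU; first by rewrite IHU.
  have [_ _ _ -> //] := IHl n h.+2 ltac:(lia).
  by rewrite weight_c addnC.
Qed.

Lemma card_dyck_paths_UUDU n : #|dyck_paths_UUDU n| = weight n 1 0.
Proof.
have [<- _ _ _] := @dyck_countE (2 * n) n 0 ltac:(lia).
by apply: eq_card => t; rewrite !inE dyck_path_from // size_tuple.
Qed.

(** * Descent sequences avoiding 021 *)

Definition descents (a : seq nat) : nat := num_descents a (size a).-1.

Definition max_entry (a : seq nat) : nat := maxn 1 (\max_(x <- a) x).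

Definition good (a : seq nat) : bool := descent_sequence a && avoids_021 a.

Lemma num_descents_sum a m : num_descents a m = \sum_(j < m) (nth 0 a j.+1 < nth 0 a j).
Proof.
by rewrite /num_descents -sum1dep_card big_mkcond; apply: eq_bigr => j _; case: (_ < _).
Qed.

Lemma num_descents_rcons a x m : m < size a -> num_descents (rcons a x) m = num_descents a m.
Proof.
move=> lt_m; rewrite !num_descents_sum; apply: eq_bigr => j _.
by rewrite !nth_rcons !ifT //; have := ltn_ord j; lia.
Qed.

Lemma descents_rcons a x : 0 < size a ->
  descents (rcons a x) = descents a + (x < last 0 a).
Proof.
move=> a0; rewrite /descents size_rcons /= -{1}(prednK a0).
rewrite num_descents_sum big_ord_recr /= -num_descents_sum num_descents_rcons ?prednK //.
by rewrite !nth_rcons prednK // ltnn eqxx leqnn nth_last.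
Qed.

Lemma descent_sequence_rcons a x : 0 < size a ->
  descent_sequence (rcons a x) = descent_sequence a && (x <= 1 + descents a).
Proof.
move=> a0; rewrite /descent_sequence nth_rcons a0 -andbA; congr (_ && _).
apply/forallP/andP => [ds | [/forallP ds le_x] [i lt_i]].
  split.
    apply/forallP => -[i lt_i]; have lt_i' : i < size (rcons a x) by rewrite size_rcons ltnW.
    have := ds (Ordinal lt_i'); rewrite /= nth_rcons lt_i num_descents_rcons //; lia.
  have lt_a : size a < size (rcons a x) by rewrite size_rcons.
  have := ds (Ordinal lt_a); rewrite /= a0 nth_rcons ltnn eqxx num_descents_rcons //; lia.
have : i <= size a by rewrite -ltnS -(size_rcons a x).
rewrite leq_eqVlt /= => /predU1P[ei | lt_ia].
  rewrite ei nth_rcons ltnn eqxx num_descents_rcons; [by rewrite le_x implybT | lia].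
by have := ds (Ordinal lt_ia); rewrite /= nth_rcons lt_ia num_descents_rcons //; lia.
Qed.

Lemma avoids_021P a :
  reflect (forall i j k, i < j < k -> k < size a ->
             nth 0 a i < nth 0 a k -> nth 0 a j <= nth 0 a k)
          (avoids_021 a).
Proof.
apply: (iffP negP) => [av i j k /andP[ij jk] lt_k ik | av].
  rewrite leqNgt; apply/negP => kj; apply: av.
  have lt_j := ltn_trans jk lt_k; have lt_i := ltn_trans ij lt_j.
  apply/existsP; exists (Ordinal lt_i); apply/existsP; exists (Ordinal lt_j).
  by apply/existsP; exists (Ordinal lt_k); rewrite /= ij jk ik kj.
case/existsP=> i /existsP[j /existsP[k /and4P[ij jk ik kj]]].
by have := av i j k; rewrite ij jk ltn_ord ik leqNgt kj => /(_ isT isT isT).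
Qed.

(** The leading 0 can play the smallest entry of the pattern, so a nonzero [x] completes a 021 as
    soon as an earlier entry exceeds it. An appended 0 never does, having no smaller entry. *)
Lemma avoids_021_rcons a x : 0 < size a -> nth 0 a 0 = 0 ->
  avoids_021 (rcons a x) = avoids_021 a && ((x == 0) || all (leq^~ x) a).
Proof.
move=> a_gt0 a0; apply/avoids_021P/andP => [av | [/avoids_021P av le_x] i j k /andP[ij jk]].
  split.
    apply/avoids_021P => i j k ijk lt_k; have := av i j k ijk.
    rewrite size_rcons ltnS ltnW // !nth_rcons lt_k !ifT; [by apply | lia | lia].
  case: posnP => //= x0; apply/(all_nthP 0) => -[|j] lt_j; first by rewrite a0.
  have := av 0 j.+1 (size a); rewrite size_rcons !nth_rcons lt_j a_gt0 ltnn eqxx a0.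
  by apply.
rewrite size_rcons ltnS leq_eqVlt => /predU1P[ek | lt_k].
  rewrite !nth_rcons ek ltnn eqxx !ifT; [|lia|lia] => lt_x.
  case/orP: le_x => [|/(all_nthP 0)]; [lia | by apply; lia].
by rewrite !nth_rcons lt_k !ifT; [apply: av; lia | lia | lia].
Qed.

Lemma good_rcons a x : 0 < size a ->
  good (rcons a x) =
  good a && ((x == 0) || (max_entry a <= x <= 1 + descents a)).
Proof.
move=> a_gt0; rewrite /good descent_sequence_rcons //.
case: (boolP (descent_sequence a)) => //= /andP[/eqP a0 _].
rewrite avoids_021_rcons // andbCA; congr (_ && _).
case: posnP => [-> //|/= x_gt0]; rewrite andbC; congr (_ && _).
rewrite /max_entry geq_max x_gt0; apply/allP/bigmax_leqP_seq => [le_x y /le_x //| le_x y].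
by move/le_x; apply.
Qed.

Lemma max_entry_rcons a x : max_entry (rcons a x) = maxn (max_entry a) x.
Proof. by rewrite /max_entry big_rcons /= maxnA. Qed.

Lemma last_max_entry a : last 0 a <= max_entry a.
Proof. by case/lastP: a => [|a x] //; rewrite last_rcons max_entry_rcons leq_maxr. Qed.

Definition slack (a : seq nat) : nat := (descents a).+1 - max_entry a.

(* The hypothesis on [N] keeps the bound on every later entry below [N]. *)
Lemma card_good N n (a : seq nat) :
  0 < size a -> good a -> max_entry a <= (descents a).+1 ->
  (descents a).+1 + n <= N ->
  #|[set t : n.-tuple 'I_N | good (a ++ map val t)]|
  = if last 0 a == 0 then weight_lt n.+1 0 (slack a).+1
    else weight n 1 (slack a).+1.
Proof.
elim: n a => [|n IHn] a a_gt0 good_a le_max le_N.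
  rewrite (card_tuple0 (fun t : seq 'I_N => good (a ++ map val t))) cats0 good_a.
  by rewrite weight_ltS; case: ifP.
rewrite (card_tuple_cons n (fun t : seq 'I_N => good (a ++ map val t))) /=.
pose F x := #|[set t : n.-tuple 'I_N | good (rcons a x ++ map val t)]|.
have prefix_good s t : good (s ++ t) -> 0 < size s -> good s.
  elim/last_ind: t => [|t y IHt]; first by rewrite cats0.
  move=> + s_gt0; rewrite -rcons_cat good_rcons ?size_cat ?addn_gt0 ?s_gt0 //.
  by case/andP=> /IHt ->.
(* A 0 after a nonzero entry creates a descent, which raises the slack by one. *)
have F0 : F 0 = weight_lt n.+1 0 (slack a + (0 < last 0 a)).+1.
  have max0 : max_entry (rcons a 0) = max_entry a by rewrite max_entry_rcons maxn0.
  rewrite /F IHn ?size_rcons ?good_rcons ?good_a ?max0 ?descents_rcons ?last_rcons //=; try lia.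
  by rewrite /slack max0 descents_rcons //; congr weight_lt; lia.
(* An admissible nonzero entry creates no descent and becomes the new maximum. *)
have FS x : 0 < x -> F x = if max_entry a <= x <= 1 + descents a
                          then weight n 1 ((descents a).+1 - x).+1 else 0.
  move=> x_gt0; case: ifP => le_x; last first.
    apply: eq_card0 => t; rewrite inE; apply/negP => /prefix_good.
    by rewrite size_rcons good_rcons // le_x good_a eqn0Ngt x_gt0 => /(_ isT).
  have /andP[max_x x_max] := le_x.
  have maxx : max_entry (rcons a x) = x by rewrite max_entry_rcons; lia.
  have desx : descents (rcons a x) = descents a.
    by rewrite descents_rcons //; have := last_max_entry a; lia.
  rewrite /F IHn ?size_rcons ?good_rcons ?good_a ?maxx ?desx ?last_rcons ?le_x ?orbT //=; try lia.
  by rewrite eqn0Ngt x_gt0 /slack maxx desx.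
have -> : \sum_(x < N) #|[set t : n.-tuple 'I_N | good (a ++ val x :: map val t)]|
          = \sum_(x < N) F x.
  by apply: eq_bigr => x _; apply: eq_card => t; rewrite !inE cat_rcons.
have Fsum : \sum_(1 <= x < N) F x = weight n.+1 0 (slack a).+1.
  have max_gt0 : 0 < max_entry a by rewrite leq_max.
  rewrite (big_cat_nat (n := max_entry a)) //=; last by lia.
  rewrite big_nat big1 ?add0n => [|x /andP[x1 x2]]; last by rewrite FS // ifF //; lia.
  rewrite (big_cat_nat (n := (descents a).+2)) //=; try lia.
  rewrite [X in _ + X]big_nat [X in _ + X]big1 ?addn0 => [|x /andP[x1 x2]]; last first.
    by rewrite FS ?ifF //; lia.
  rewrite weight_sum -(big_mkord xpredT (fun j => weight n 1 j.+1)) /slack.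
  (* Reversed and shifted, the sum is indexed by the slack left after the new entry. *)
  rewrite big_nat_rev /= -{1}[max_entry a]add0n big_addn.
  rewrite (_ : (descents a).+2 - max_entry a = ((descents a).+1 - max_entry a).+1); last by lia.
  rewrite big_nat [RHS]big_nat; apply: eq_bigr => x /andP[_ lt_x].
  by rewrite FS; [rewrite ifT; [congr (weight _ _ _.+1); lia | lia] | lia].
rewrite -(big_mkord xpredT F) big_ltn ?F0 ?Fsum; last by lia.
(* After a 0 this is [1 / (1 - x) = 1 + x / (1 - x)] times [c^(s+1)]; after a nonzero entry it is
   the equation for [P] times [c^(s+1)]. *)
case: posnP => _; first by rewrite addn0 [RHS]weight_ltS.
by rewrite addn1 weight_P addnC.
Qed.

Lemma card_descent_sequences_021 n : #|descent_sequences_021 n| = weight n 1 0.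
Proof.
case: n => [|n].
  have good_nil : good [::].
    by apply/andP; split; [apply/andP; split=> //; apply/forallP => -[] | apply/avoids_021P].
  rewrite -[RHS]/(nat_of_bool true) -good_nil.
  by rewrite -(card_tuple0 (fun t : seq 'I_0 => good (map val t))).
have -> : #|descent_sequences_021 n.+1| =
          #|[set t : n.+1.-tuple 'I_n.+1 | good (map val t)]| by [].
rewrite (card_tuple_cons n (fun t : seq 'I_n.+1 => good (map val t))) big_ord_recl /=.
rewrite big1 ?addn0 => [|x _]; last first.
  by apply: eq_card0 => t; rewrite inE /good /descent_sequence.
have good0 : good [:: 0].
  rewrite /good; apply/andP; split; last by apply/avoids_021P => i j [|k].
  by rewrite /descent_sequence /=; apply/forallP => -[[|i]].
have max0 : max_entry [:: 0] = 1 by rewrite /max_entry big_seq1.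
have des0 : descents [:: 0] = 0 by rewrite /descents num_descents_sum big_ord0.
have := @card_good n.+1 n [:: 0] isT good0; rewrite /slack max0 des0 => -> //.
(* With slack 0, the count is the coefficient of [x^(n+1)] in [x / (1 - x) c = P - 1]. *)
by rewrite (weight_P n.+1 0 0) weight00.
Qed.

Theorem mainTheorem7 (n : nat) :
  #|descent_sequences_021 n| = #|dyck_paths_UUDU n|.
Proof. by rewrite card_descent_sequences_021 card_dyck_paths_UUDU. Qed.
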